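(* In a minimal setup $(G,Z,\delta)$, $\mathrm{Rad}\,f=\mathrm{Rad}\,g$ and $\mathrm{Im}\,f\setminus\{1\}$ consists of the unique involution of $Z$.
   Context: Conventions: $x^y=y^{-1}xy$, $[x,y]=x^{-1}y^{-1}xy$; $G'$ is the derived subgroup, $Z(G)$ the center. A (new) setup $(G,Z,\delta)$ consists of a group $G$, a subgroup $Z\le Z(G)$ and a mapping $\delta:G/Z\times G/Z\to Z$ (written $\delta(x,y)$ for $\delta(xZ,yZ)$) such that: $\delta(x,x)=1$ for every $x\in G$; $\delta(x,y)=\delta(y,x)^{-1}$ for every $x,y\in G$; $\delta(xy,z)=\delta(x,z)\delta(y,z)$ whenever $x,y,z\in G$ and $\{x,y,z\}\cap G'\neq\emptyset$; $z^{yx}\delta([z,y],x)=z^{xy}\delta([z,x],y)$ for every $x,y,z\in G$. Mappings $f,g:G^3\to Z$ are defined by $f(x,y,z)=\delta([x,y],z)$ and $g(x,y,z)=f(x,y,z)f(y,z,x)f(z,x,y)$. They are homomorphisms in each argument, and for such a mapping $\varphi:G^3\to Z$, $\mathrm{Rad}\,\varphi=\{t\in G:\varphi(t,x,y)=\varphi(x,t,y)=\varphi(x,y,t)=1\text{ for all }x,y\in G\}$. A setup is nontrivial if $g$ is not identically $1$. A minimal setup is a nontrivial setup with $|G|$ as small as possible among all nontrivial setups. It is known from earlier work of the authors that nontrivial setups with $|G|=128$ exist, so $|G|\le 128$ in a minimal setup. In a minimal setup the group $Z$ is cyclic of even order, so it has a unique involution. *)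

(* Defs.v *)
From mathcomp Require Import all_boot all_fingroup all_solvable.

Set Implicit Arguments.
Unset Strict Implicit.
Unset Printing Implicit Defensive.

Local Open Scope group_scope.

Section Setup.

Variables (gT : finGroupType) (G Z : {group gT}).
Variable delta : coset_of Z -> coset_of Z -> gT.

(* The paper's delta(x, y), that is, delta(xZ, yZ); coset Z x is the actual
   coset xZ for x in G, since G centralises Z in a setup. *)
Definition delta_rep (x y : gT) : gT := delta (coset Z x) (coset Z y).

(* The values of delta outside G / Z are irrelevant: every clause below, and
   every later definition, only evaluates delta on G / Z. *)
Record is_setup : Prop := IsSetup {
  setup_central : Z \subset 'Z(G);
  setup_codom : {in G / Z &, forall a b, delta a b \in Z};
  setup_diag : {in G, forall x, delta_rep x x = 1};
  setup_antisym : {in G &, forall x y, delta_rep x y = (delta_rep y x)^-1};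
  setup_mul : {in G & &, forall x y z,
    [|| x \in G^`(1), y \in G^`(1) | z \in G^`(1)] ->
    delta_rep (x * y) z = delta_rep x z * delta_rep y z};
  setup_conj : {in G & &, forall x y z,
    z ^ (y * x) * delta_rep [~ z, y] x = z ^ (x * y) * delta_rep [~ z, x] y}
}.

Definition setup_f (x y z : gT) : gT := delta_rep [~ x, y] z.

Definition setup_g (x y z : gT) : gT :=
  setup_f x y z * setup_f y z x * setup_f z x y.

Definition nontrivial_setup : Prop :=
  is_setup /\
  exists x y z, [/\ x \in G, y \in G, z \in G & setup_g x y z != 1].

Definition Rad (phi : gT -> gT -> gT -> gT) : {set gT} :=
  [set t in G | [forall x in G, forall y in G,
    [&& phi t x y == 1, phi x t y == 1 & phi x y t == 1]]].

Definition Im3 (phi : gT -> gT -> gT -> gT) : {set gT} :=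
  [set phi p.1.1 p.1.2 p.2 | p in setX (setX G G) G].

End Setup.

(* Nontrivial setups on finite groups exist, so comparing only with finite
   groups is the same as comparing with all groups. *)
Definition minimal_setup (gT : finGroupType) (G Z : {group gT})
    (delta : coset_of Z -> coset_of Z -> gT) : Prop :=
  nontrivial_setup G delta /\
  forall (hT : finGroupType) (H W : {group hT})
         (eps : coset_of W -> coset_of W -> hT),
    nontrivial_setup H eps -> #|G| <= #|H|.

(* Main.v *)
From HB Require Import structures.
Require Import Defs.
From mathcomp Require Import all_boot all_fingroup all_algebra all_solvable.
From mathcomp Require Import ring.

Set Implicit Arguments.
Unset Strict Implicit.
Unset Printing Implicit Defensive.

Local Open Scope group_scope.

(** The proof compares two bounds on the order of [G].

The upper bound is [|G| <= 128]: the elementary abelian group [V] of order 8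
extends, by its exterior square and a further central factor [Z] of order 2, to
a group of order 128 and class two, and pairing the exterior square with [V]
defines a setup in which [f] and [g] are both the determinant of [V]
([ext_setup_nontrivial], [card_ext]).

The lower bound holds in every nontrivial setup. The last axiom forces [G / Z]
to have class at most two ([commg_der_Z]) and computes the commutators of weight
three. As a consequence [gamma(c, t) = [~ c, t] * delta(c, t)] is a bimultiplicative
pairing of [G'] with [G], trivial on the intersection of [G'] with [Z], with
[gamma([~ x, y], t) = g x y t] ([gamma_comm]). In particular [g] is multiplicative
in its last argument; being cyclic with [g x x y = 1], it is multiplicative in
each argument and alternating. If [g x y z] is not 1, then evaluating [g] and
[gamma] exhibits [x], [y], [z] as independent modulo [Rad g], and the three
commutators of [x], [y], [z] as independent modulo [Z]. Hence
[|G| >= 8 |Rad g|] and [|G'Z| >= 8 |Z|] ([setup_index_Rad_g], [setup_index_Z]).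

Finally [G'Z] is contained in [Rad f], which is contained in [Rad g], and [Z] has
at least two elements, so
[128 >= |G| >= 8 |Rad g| >= 8 |Rad f| >= 8 |G'Z| >= 64 |Z| >= 128].
All of these are equalities: the radicals coincide, and [Z] has order 2, which
leaves the involution of [Z] as the only possible nontrivial value of [f]. *)

(** * Homomorphisms and orders *)

Lemma morph_index2 (aT rT : finGroupType) (D : {group aT})
    (K : {group aT}) (f : {morphism D >-> rT}) x :
  x \in K -> x \in D -> f x != 1 -> 2 * #|K :&: 'ker f| <= #|K|.
Proof.
move=> Kx Dx nfx1; have pr: K :&: 'ker f \proper K.
  apply/properP; split; first exact: subsetIl.
  by exists x => //; apply: contra nfx1; rewrite inE => /andP[_ /mker->].
rewrite -(LagrangeI K ('ker f)) mulnC leq_pmul2l ?cardG_gt0 //.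
by rewrite indexg_gt1; move: pr; rewrite properE subsetIl subsetI subxx.
Qed.

(** Three homomorphisms in triangular position cut out the strictly decreasing
chain of subgroups 'ker f1 > 'ker f1 :&: 'ker f2 > ..., with [x_i] witnessing
the [i]-th strict inclusion; each step at least halves the order. [N] is a mere
set so that the lemma applies to a radical before it is known to be a group. *)
Lemma dual_triple_index (aT rT : finGroupType) (D : {group aT})
    (N : {set aT}) (f1 f2 f3 : {morphism D >-> rT}) x1 x2 x3 :
  x1 \in D -> x2 \in D -> x3 \in D ->
  f1 x1 != 1 -> f1 x2 = 1 -> f2 x2 != 1 -> f1 x3 = 1 -> f2 x3 = 1 ->
  f3 x3 != 1 -> N \subset 'ker f1 :&: 'ker f2 :&: 'ker f3 ->
  8 * #|N| <= #|D|.
Proof.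
move=> D1 D2 D3 n11 f12 n22 f13 f23 n33 sNK.
have le1 := morph_index2 D1 D1 n11; rewrite setIC (setIidPl (subsetIl _ _)) in le1.
have x2K: x2 \in [group of 'ker f1] by apply/kerP.
have x3K: x3 \in [group of 'ker f1 :&: 'ker f2].
  by apply/setIP; split; apply/kerP.
have le2 := morph_index2 x2K D2 n22.
have le3 := morph_index2 x3K D3 n33.
apply: leq_trans le1; rewrite -[8]/(2 * (2 * 2))%N -!mulnA leq_pmul2l //.
apply: leq_trans le2; rewrite leq_pmul2l //.
by apply: leq_trans le3; rewrite leq_pmul2l //; apply: subset_leq_card.
Qed.

Lemma morph_abelian_der1 (aT rT : finGroupType) (D : {group aT})
    (A : {group rT}) (f : {morphism D >-> rT}) :
  abelian A -> {in D, forall x, f x \in A} -> D^`(1) \subset 'ker f.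
Proof.
move=> abA fA; rewrite ker_trivg_morphim der_sub morphim_der //.
apply/trivgP/derG1P/(abelianS _ abA).
by apply/subsetP=> _ /morphimP[x Dx _ ->]; apply: fA.
Qed.

(** * Multilinearity in a setup *)

Section SetupTheory.

Variables (gT : finGroupType) (G Z : {group gT}).
Variable delta : coset_of Z -> coset_of Z -> gT.
Hypothesis hS : is_setup G delta.

Local Notation d := (delta_rep delta).
Local Notation f := (setup_f delta).
Local Notation g := (setup_g delta).

Let sZG : Z \subset G.
Proof. exact: subset_trans (setup_central hS) (center_sub G). Qed.

Let cZ z x : z \in Z -> x \in G -> z * x = x * z.
Proof.
by move=> Zz Gx; have /centerP[_ ->] := subsetP (setup_central hS) z Zz.
Qed.

Let cZZ y z : y \in Z -> z \in Z -> y * z = z * y.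
Proof. by move=> Zy Zz; rewrite cZ ?(subsetP sZG). Qed.

Let ZACA a b c e : b \in Z -> c \in Z -> a * b * (c * e) = a * c * (b * e).
Proof.
by move=> Zb Zc; rewrite -!mulgA; congr (_ * _); rewrite !mulgA (cZZ Zb Zc).
Qed.

Let abZ : abelian Z.
Proof. exact: abelianS (setup_central hS) (center_abelian G). Qed.

Let nZG : G \subset 'N(Z).
Proof.
apply/normal_norm/sub_center_normal; exact: setup_central hS.
Qed.

Let fixZ z x : z \in Z -> x \in G -> z ^ x = z.
Proof. by move=> Zz Gx; rewrite conjgE (cZ Zz Gx) mulKg. Qed.

Let der_in c : c \in G^`(1) -> c \in G.
Proof. exact/subsetP/der_sub. Qed.

Let commD : {in G &, forall x y, [~ x, y] \in G^`(1)}.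
Proof. by move=> x y Gx Gy; rewrite derg1 mem_commg. Qed.

Lemma delta_rep_Z : {in G &, forall x y, d x y \in Z}.
Proof. by move=> x y Gx Gy; apply: (setup_codom hS); rewrite mem_quotient. Qed.

(** Since [x * y = (y * x) * [~ x, y]], the conjugates of [z] by [x * y] and by
[y * x] differ by a conjugation by [[~ x, y]], so the last setup axiom evaluates
a commutator of weight three. *)
Lemma commg_der_conj :
  {in G & &, forall x y z, [~ z ^ (y * x), [~ x, y]]
    = d [~ z, y] x * (d [~ z, x] y)^-1}.
Proof.
move=> x y z Gx Gy Gz; set w := z ^ (y * x).
have Zl : d [~ z, y] x \in Z by rewrite delta_rep_Z ?groupR.
have Zr : d [~ z, x] y \in Z by rewrite delta_rep_Z ?groupR.
have Gw : w \in G by rewrite groupJ ?groupM.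
have := setup_conj hS Gx Gy Gz; rewrite -/w (_ : x * y = y * x * [~ x, y]).
  rewrite conjgM -/w => E; rewrite commgEl.
  apply: (mulgI w); apply: (mulIg (d [~ z, x] y)).
  by rewrite mulKVg -E -!mulgA mulVg mulg1.
by rewrite -commgC.
Qed.

(** The formula above puts the commutators of [[~ x, y]] with the conjugates
[z ^ (y * x)] into [Z], and these conjugates exhaust [G]. Hence [G / Z] has
class at most two. *)
Lemma commg_der_Z : [~: G^`(1), G] \subset Z.
Proof.
rewrite -quotient_cents2 ?(subset_trans (der_sub 1 G)) //.
rewrite derg1 quotientR // gen_subG.
apply/subsetP=> _ /imset2P[_ _ /morphimP[x Nx Gx ->] /morphimP[y Ny Gy ->] ->].
rewrite -morphR //; apply/centP=> _ /morphimP[w Nw Gw ->].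
have [z Gz def_w] : exists2 z, z \in G & w = z ^ (y * x).
  by exists (w ^ (y * x)^-1); rewrite ?conjgKV ?groupJ ?groupV ?groupM.
have wZ : [~ w, [~ x, y]] \in Z.
  by rewrite def_w commg_der_conj // groupM ?groupV ?delta_rep_Z ?groupR.
apply/commgP; rewrite -morphR ?groupR //; apply/eqP/coset_id.
by rewrite -invg_comm groupV.
Qed.

Let Zcomm c t : c \in G^`(1) -> t \in G -> [~ c, t] \in Z.
Proof. by move=> Dc Gt; apply: (subsetP commg_der_Z); apply: mem_commg. Qed.

Lemma delta_rep_derMl :
  {in G^`(1) & G, forall c t, {in G^`(1), forall c', d (c * c') t = d c t * d c' t}}.
Proof.
by move=> c t Dc Gt c' Dc'; rewrite (setup_mul hS (der_in Dc) (der_in Dc') Gt) ?Dc.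
Qed.

Lemma delta_rep_derMr :
  {in G^`(1), forall c, {in G &, {morph d c : s t / s * t}}}.
Proof.
move=> c Dc s t Gs Gt /=; have Gc := der_in Dc.
rewrite !(setup_antisym hS Gc) ?groupM // (setup_mul hS) // ?Dc ?orbT // invMg.
by rewrite cZZ // groupV delta_rep_Z.
Qed.

Lemma delta_rep_Z1 : {in Z & G, forall z t, d z t = 1}.
Proof.
move=> z t Zz Gt; rewrite /delta_rep (coset_id Zz) -(coset_id (group1 Z)).
apply: (mulgI (d 1 t)).
by rewrite mulg1 -[LHS](delta_rep_derMl (group1 _) Gt (group1 _)) mulg1.
Qed.

(** For [c] in [G'], [delta(c, -)] is a homomorphism to an abelian group, hence
kills [G']. *)
Lemma delta_rep_der_der : {in G^`(1) &, forall c t, d c t = 1}.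
Proof.
move=> c t Dc Dt; have Gc := der_in Dc.
pose m := Morphism (delta_rep_derMr Dc).
apply: (@mker _ _ _ m); apply: subsetP Dt; apply: (morph_abelian_der1 abZ).
by move=> x Gx; apply: delta_rep_Z.
Qed.

(** The pairing [G' x G -> Z] that carries the proof. [delta] alone pairs
[[~ x, y]] with [z] to [f x y z]; correcting it by the commutator turns this
value into [g x y z] while keeping [Z] in the radical, as both factors kill the
central subgroup [Z]. *)
Let gamma c t := [~ c, t] * d c t.

Let gammaZ c t : c \in G^`(1) -> t \in G -> gamma c t \in Z.
Proof. by move=> Dc Gt; rewrite groupM ?Zcomm ?delta_rep_Z // der_in. Qed.

Let gammaMl t : t \in G -> {in G^`(1) &, {morph gamma^~ t : c c' / c * c'}}.
Proof.
move=> Gt c c' Dc Dc' /=; have Gc := der_in Dc'.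
rewrite /gamma commMgJ delta_rep_derMl // fixZ ?Zcomm //.
by apply: ZACA; [apply: Zcomm | apply: delta_rep_Z => //; apply: der_in].
Qed.

Let gammaMr c : c \in G^`(1) -> {in G &, {morph gamma c : s t / s * t}}.
Proof.
move=> Dc s t Gs Gt /=; have Gc := der_in Dc.
rewrite /gamma commgMJ delta_rep_derMr // fixZ ?Zcomm //.
rewrite (cZZ (Zcomm Dc Gt) (Zcomm Dc Gs)).
by apply: ZACA; [apply: Zcomm | apply: delta_rep_Z].
Qed.

(** As [[~ x, y]] acts on [G] through a homomorphism to [Z], its commutator with
[z] is also its commutator with [z ^ (y * x)], which [commg_der_conj] expresses
as [f z x y * f y z x]. *)
Let gamma_comm : {in G & &, forall x y t, gamma [~ x, y] t = g x y t}.
Proof.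
move=> x y z Gx Gy Gz; have Dc := commD Gx Gy.
have cM : {in G &, {morph commg [~ x, y] : s t / s * t}}.
  move=> s t Gs Gt /=; rewrite commgMJ fixZ ?Zcomm //.
  by rewrite (cZZ (Zcomm Dc Gt) (Zcomm Dc Gs)).
pose m := Morphism cM.
have Gw := groupM Gy Gx.
have -> : gamma [~ x, y] z = [~ [~ x, y], z ^ (y * x)] * d [~ x, y] z.
  congr (_ * _); rewrite -[RHS]/(m _) morphJ // -[LHS]/(m z).
  by rewrite fixZ ?(subsetP sZG) //; apply: Zcomm.
rewrite -invg_comm commg_der_conj // invMg invgK /g /setup_f.
have -> : (d [~ z, y] x)^-1 = d [~ y, z] x.
  apply: (mulgI (d [~ z, y] x)); rewrite mulgV -delta_rep_derMl ?commD //.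
  by rewrite -(invg_comm y z) mulVg delta_rep_Z1 // group1.
set a := d _ _; set b := d _ _; set c := d _ _.
have Za : a \in Z by rewrite delta_rep_Z ?groupR.
have Zb : b \in Z by rewrite delta_rep_Z ?groupR.
have Zc : c \in Z by rewrite delta_rep_Z ?groupR.
by rewrite (cZZ Za Zb) (cZZ _ Zc) ?groupM // mulgA.
Qed.

Lemma setup_gZ : {in G & &, forall x y z, g x y z \in Z}.
Proof. by move=> x y z Gx Gy Gz; rewrite -gamma_comm // gammaZ ?commD. Qed.

Lemma setup_gC : {in G & &, forall x y z, g x y z = g y z x}.
Proof.
move=> x y z Gx Gy Gz; rewrite /g -mulgA cZZ //.
  by rewrite /f delta_rep_Z ?groupR.
by rewrite groupM // /f delta_rep_Z ?groupR.
Qed.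

Lemma setup_gM : {in G &, forall x y, {in G &, {morph g x y : s t / s * t}}}.
Proof.
by move=> x y Gx Gy s t Gs Gt /=; rewrite -!gamma_comm ?groupM // gammaMr ?commD.
Qed.

Lemma setup_g_alt : {in G &, forall x y, [/\ g x x y = 1, g x y x = 1 & g y x x = 1]}.
Proof.
move=> x y Gx Gy; have g1 : g x x y = 1.
  rewrite -gamma_comm // commgg /gamma comm1g mul1g.
  by rewrite delta_rep_Z1 ?group1.
by rewrite (setup_gC Gx Gy Gx) (setup_gC Gy Gx Gx).
Qed.

(** An element of [G'Z] has its commutators in [Z], which [delta] ignores; this
settles the first two arguments of [f]. In the last one [f] is a homomorphism to
an abelian group. *)
Lemma derZ_Rad_f : G^`(1) * Z \subset Rad G f.
Proof.
apply/subsetP=> _ /mulsgP[c z Dc Zz ->].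
have Gc := der_in Dc; have Gz := subsetP sZG z Zz.
have cz_Z : {in G, forall x, [~ c * z, x] \in Z}.
  move=> x Gx; rewrite commMgJ (_ : [~ z, x] = 1); last exact/eqP/commgP/cZ.
  by rewrite mulg1 memJ_norm ?Zcomm // (subsetP nZG).
rewrite inE groupM //=; apply/'forall_implyP=> x Gx; apply/'forall_implyP=> y Gy.
apply/and3P; split; apply/eqP.
- by rewrite /f delta_rep_Z1 ?cz_Z.
- by rewrite /f delta_rep_Z1 // -invg_comm groupV cz_Z.
rewrite /f delta_rep_derMr ?commD // delta_rep_der_der ?commD // mul1g.
by rewrite (setup_antisym hS) ?groupR // delta_rep_Z1 ?invg1 ?groupR.
Qed.

Lemma Rad_f_g : Rad G f \subset Rad G g.
Proof.
apply/subsetP=> t; rewrite !inE => /andP[Gt /'forall_implyP Rt].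
rewrite Gt; apply/'forall_implyP=> x Gx; apply/'forall_implyP=> y Gy.
have /'forall_implyP/(_ y Gy)/and3P[/eqP f1 /eqP f2 /eqP f3] := Rt x Gx.
have /'forall_implyP/(_ x Gx)/and3P[/eqP f4 /eqP f5 /eqP f6] := Rt y Gy.
by rewrite /g f1 f2 f3 f4 f5 f6 !mulg1 eqxx.
Qed.

(** * Size of a nontrivial setup *)

Section Nontrivial.

Variables x y z : gT.
Hypotheses (Gx : x \in G) (Gy : y \in G) (Gz : z \in G).
Hypothesis ng : g x y z != 1.

(** The maps [g(y, z, -)], [g(z, x, -)] and [g(x, y, -)] are dual to [x], [y],
[z], because [g] is cyclic and alternating. *)
Lemma setup_index_Rad_g : 8 * #|Rad G g| <= #|G|.
Proof.
pose m1 := Morphism (setup_gM Gy Gz).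
pose m2 := Morphism (setup_gM Gz Gx).
pose m3 := Morphism (setup_gM Gx Gy).
apply: (@dual_triple_index _ _ G _ m1 m2 m3 x y z) => //=.
- by rewrite -setup_gC.
- by have [] := setup_g_alt Gy Gz.
- by rewrite -setup_gC // -setup_gC.
- by have [] := setup_g_alt Gz Gy.
- by have [] := setup_g_alt Gz Gx.
apply/subsetP=> t; rewrite inE => /andP[Gt /'forall_implyP Rt].
have R u v : u \in G -> v \in G -> g u v t = 1.
  by move=> Gu Gv; have /'forall_implyP/(_ v Gv)/and3P[_ _ /eqP] := Rt u Gu.
by rewrite !inE Gt /= !R // eqxx.
Qed.

(** The maps [gamma(-, z)], [gamma(-, x)], [gamma(-, y)] on [G'] are dual to the
three commutators of [x], [y], [z], and they kill the intersection of [G'] with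
[Z]. *)
Lemma setup_index_Z : 8 * #|Z| <= #|G^`(1) * Z|.
Proof.
pose m1 := Morphism (gammaMl Gz).
pose m2 := Morphism (gammaMl Gx).
pose m3 := Morphism (gammaMl Gy).
rewrite -(leq_pmul2r (cardG_gt0 (G^`(1) :&: Z))) -mul_cardG mulnAC leq_pmul2r //.
apply: (@dual_triple_index _ _ _ _ m1 m2 m3 [~ x, y] [~ y, z] [~ z, x]);
  rewrite ?commD //= ?gamma_comm //.
- by have [] := setup_g_alt Gz Gy.
- by rewrite -setup_gC.
- by have [] := setup_g_alt Gz Gx.
- by have [] := setup_g_alt Gx Gz.
- by rewrite setup_gC.
apply/subsetP=> c /setIP[Dc Zc].
have c1 t : t \in G -> gamma c t = 1.
  move=> Gt; rewrite /gamma delta_rep_Z1 // mulg1.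
  by apply/eqP/commgP/cZ.
by rewrite !inE Dc /= !c1 // eqxx.
Qed.

(** [128 >= |G| >= 8 |Rad g| >= 8 |Rad f| >= 8 |G'Z| >= 64 |Z| >= 128]. *)
Lemma small_setup : #|G| <= 128 -> #|Z| = 2 /\ Rad G f = Rad G g.
Proof.
move=> leG; have le1 := leq_trans setup_index_Rad_g leG.
have leR : #|Rad G g| <= 16 by rewrite -(leq_pmul2l (isT : 0 < 8)).
have le2 := leq_trans setup_index_Z (subset_leq_card derZ_Rad_f).
have le3 := subset_leq_card Rad_f_g.
have Z2 : 2 <= #|Z|.
  rewrite cardG_gt1; apply: contra ng => /eqP Z1.
  by have := setup_gZ Gx Gy Gz; rewrite Z1 inE.
have Z2' : #|Z| = 2.
  apply/eqP; rewrite eqn_leq Z2 andbT -(leq_pmul2l (isT : 0 < 8)).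
  exact: leq_trans le2 (leq_trans le3 leR).
split=> //; apply/eqP; rewrite eqEcard Rad_f_g.
by apply: leq_trans leR _; rewrite Z2' in le2.
Qed.

End Nontrivial.

End SetupTheory.

(** * A nontrivial setup of order 128 *)

Section Example.
Import GRing.Theory.

Local Notation V := ('rV['F_2]_3).

(** With [V] the space of row vectors of length three, antisymmetrizing this
bilinear map yields the cross product (up to a permutation of the coordinates),
so that in the group below the commutator map is the universal alternating map
on [V]. *)
Definition cocycle (v w : V) : V := (\row_i (v ord0 i * w ord0 (i + 1)))%R.

(** Coordinate [i] of the cocycle involves the indices [i] and [i + 1] modulo 3;
pairing it with the remaining index [i + 2] makes the triple product of three
vectors their determinant. *)
Definition pairing (w v : V) : 'F_2 := (\sum_i w ord0 i * v ord0 (i + 2))%R.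

(** A triple [(u, (v, s))] has its image in [G / G'Z] in [u], its [G'] part in [v]
and its [Z] part in [s]. The [Z] part is a direct factor of the group, which
only [delta] links to the other two. *)
Definition ext_type : Type := (V * (V * 'F_2))%type.

HB.instance Definition _ := Finite.copy ext_type (V * (V * 'F_2))%type.

Implicit Types a b c : ext_type.

Definition ext_mul a b : ext_type :=
  ((a.1 + b.1)%R, ((a.2.1 + b.2.1 + cocycle a.1 b.1)%R, (a.2.2 + b.2.2)%R)).

Definition ext_one : ext_type := (0%R, (0%R, 0%R)).

Definition ext_inv a : ext_type :=
  ((- a.1)%R, ((- a.2.1 + cocycle a.1 a.1)%R, (- a.2.2)%R)).

Lemma ext_mulA : associative ext_mul.
Proof.
move=> a b c; congr (_, (_, _)); rewrite /= ?addrA //.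
by apply/rowP=> i; rewrite !mxE; ring.
Qed.

Lemma ext_mul1 : left_id ext_one ext_mul.
Proof.
move=> [u [v s]]; congr (_, (_, _)); rewrite /= ?add0r //.
by apply/rowP=> i; rewrite !mxE; ring.
Qed.

Lemma ext_mulV : left_inverse ext_one ext_inv ext_mul.
Proof.
move=> [u [v s]]; congr (_, (_, _)); rewrite /= ?addNr //.
by apply/rowP=> i; rewrite !mxE; ring.
Qed.

HB.instance Definition _ :=
  Finite_isGroup.Build ext_type ext_mulA ext_mul1 ext_mulV.

Lemma ext_mulE a b : a * b = ext_mul a b. Proof. by []. Qed.

Definition ext_Z := [set a : ext_type | a.1 == 0%R & a.2.1 == 0%R].

Lemma ext_Z_group_set : group_set ext_Z.
Proof.
apply/group_setP; split; first by rewrite inE /= !eqxx.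
move=> a b; rewrite !inE => /andP[/eqP a1 /eqP a2] /andP[/eqP b1 /eqP b2].
rewrite ext_mulE /= a1 a2 b1 b2 !add0r eqxx; apply/eqP.
by apply/rowP=> i; rewrite !mxE mul0r.
Qed.

Canonical ext_Z_Group := Group ext_Z_group_set.

Definition ext_pair a b : ext_type :=
  (0, (0, pairing a.2.1 b.1 - pairing b.2.1 a.1))%R.

Definition ext_delta (A B : coset_of ext_Z_Group) : ext_type :=
  ext_pair (repr A) (repr B).

Lemma ext_comm a b :
  [~ a, b] = (0, (cocycle a.1 b.1 - cocycle b.1 a.1, 0))%R :> ext_type.
Proof.
apply: (mulgI (b * a)); rewrite -commgC !ext_mulE.
congr (_, (_, _)); rewrite /= ?addr0 1?addrC //.
by apply/rowP=> i; rewrite !mxE; ring.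
Qed.

Lemma ext_Z_central : ext_Z \subset 'Z([set: ext_type]).
Proof.
apply/subsetP=> a; rewrite inE => /andP[/eqP a1 /eqP a2].
apply/centerP; split=> [|b _]; first by rewrite inE.
rewrite /commute !ext_mulE; congr (_, (_, _)); rewrite 1?addrC //.
by apply/rowP=> i; rewrite a1 !mxE; ring.
Qed.

Lemma ext_coset_repr a : (repr (coset ext_Z_Group a)).1 = a.1 /\
  (repr (coset ext_Z_Group a)).2.1 = a.2.1.
Proof.
have Na : a \in 'N(ext_Z_Group).
  have /normal_norm/subsetP := sub_center_normal ext_Z_central.
  by apply; rewrite inE.
have := mem_repr_coset (coset ext_Z_Group a).
rewrite val_coset // => /rcosetP[z]; rewrite inE => /andP[/eqP z1 /eqP z2] ->.
rewrite ext_mulE /= z1 z2 !add0r; split=> //.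
by apply/rowP=> i; rewrite !mxE; ring.
Qed.

Lemma ext_deltaE a b : delta_rep ext_delta a b = ext_pair a b.
Proof.
rewrite /delta_rep /ext_delta /ext_pair.
by have [-> ->] := ext_coset_repr a; have [-> ->] := ext_coset_repr b.
Qed.

Lemma ext_der a : a \in [set: ext_type]^`(1) -> a.1 = 0%R.
Proof.
pose K := [set a : ext_type | a.1 == 0%R].
have gK : group_set K.
  apply/group_setP; split=> [|x y]; first by rewrite inE /=.
  rewrite !inE.
  by move=> /eqP x1 /eqP y1; rewrite ext_mulE /= x1 y1 addr0.
have sK : [set: ext_type]^`(1) \subset Group gK.
  rewrite derg1 gen_subG; apply/subsetP=> _ /imset2P[x y _ _ ->].
  by rewrite inE ext_comm.
by move/(subsetP sK); rewrite inE => /eqP.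
Qed.

Lemma ext_pairM a b c : [|| a.1 == 0%R, b.1 == 0%R | c.1 == 0%R] ->
  ext_pair (a * b) c = ext_pair a c * ext_pair b c.
Proof.
move=> abc; rewrite !ext_mulE; congr (_, (_, _)); rewrite /= ?addr0 //.
  by apply/rowP=> i; rewrite !mxE; ring.
rewrite /pairing /= !big_ord_recl !big_ord0 !mxE.
by case/or3P: abc => /eqP->; rewrite !mxE; ring.
Qed.

Lemma pairing0r w : pairing w 0%R = 0%R.
Proof. by rewrite /pairing big1 // => i _; rewrite mxE mulr0. Qed.

Lemma pairing_crossE u v w :
  pairing (cocycle u v - cocycle v u)%R w =
  ((u 0 0 * v 0 1 - v 0 0 * u 0 1) * w 0 2 +
   (u 0 1 * v 0 2 - v 0 1 * u 0 2) * w 0 0 +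
   (u 0 2 * v 0 0 - v 0 2 * u 0 0) * w 0 1)%R.
Proof.
rewrite /pairing !big_ord_recl big_ord0 !mxE.
have e1 : lift ord0 ord0 = 1%R :> 'I_3 by apply: val_inj.
have e2 : lift ord0 (lift ord0 ord0) = 2%R :> 'I_3 by apply: val_inj.
have e3 : (1 + 1 = 2 :> 'I_3)%R by apply: val_inj.
have e4 : (2 + 1 = 0 :> 'I_3)%R by apply: val_inj.
have e5 : (1 + 2 = 0 :> 'I_3)%R by apply: val_inj.
have e6 : (2 + 2 = 1 :> 'I_3)%R by apply: val_inj.
rewrite e1 e2 e3 e4 e5 e6 !add0r; ring.
Qed.

(** The determinant is alternating, and signs disappear in characteristic 2. *)
Lemma pairing_crossC u v w :
  pairing (cocycle u v - cocycle v u)%R w =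
  pairing (cocycle u w - cocycle w u)%R v.
Proof.
rewrite -[LHS](oppr_pchar2 (pchar_Fp (isT : prime 2))) !pairing_crossE.
ring.
Qed.

(** The group has class two, so both conjugates in the last axiom agree, and this
axiom reduces to the symmetry of the determinant modulo 2. Multiplicativity can
only fail by the pairing of [cocycle a.1 b.1] with [c.1], which vanishes once
one of the three elements is in the derived subgroup. *)
Lemma ext_setup : is_setup [set: ext_type]%G ext_delta.
Proof.
split.
- exact: ext_Z_central.
- by move=> A B _ _; rewrite inE /= !eqxx.
- by move=> a _; rewrite ext_deltaE /ext_pair subrr.
- move=> a b _ _; rewrite !ext_deltaE; congr (_, (_, _)).
  + by rewrite oppr0.
  + by apply/rowP=> i; rewrite !mxE; ring.
  + by rewrite /= opprB.
- move=> a b c _ _ _ abc; rewrite !ext_deltaE ext_pairM //.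
  by case/or3P: abc => /ext_der->; rewrite eqxx ?orbT.
move=> a b c _ _ _; rewrite !ext_deltaE !conjg_mulR /ext_pair !ext_comm /=.
by rewrite pairing_crossC !pairing0r [(b.1 + a.1)%R]addrC.
Qed.

(** Here [f] is the determinant, which is cyclic, so [g = 3 f = f] takes the
value 1 at the standard basis. *)
Lemma ext_setup_nontrivial : nontrivial_setup [set: ext_type]%G ext_delta.
Proof.
split; first exact: ext_setup.
pose e i : ext_type := (delta_mx 0 i, (0, 0))%R.
exists (e 0%R), (e 1%R), (e 2%R); split; rewrite ?inE //.
rewrite /setup_g /setup_f !ext_deltaE /ext_pair !ext_comm !ext_mulE.
apply/eqP=> /(congr1 (fun a : ext_type => a.2.2)) /=.
by rewrite !pairing_crossE !pairing0r !mxE /= => /eqP.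
Qed.

Lemma card_ext : #|[set: ext_type]| = 128.
Proof.
by rewrite cardsT !card_prod !card_mx !card_Fp.
Qed.

End Example.

(** * Minimal setups *)

Theorem lemma6p5 (gT : finGroupType) (G Z : {group gT})
    (delta : coset_of Z -> coset_of Z -> gT)
    (hmin : minimal_setup G delta) :
  Rad G (setup_f delta) = Rad G (setup_g delta) /\
  exists u : gT,
    [set z in Z | #[z] == 2] = [set u] /\
    Im3 G (setup_f delta) :\ 1 = [set u].
Proof.
have [[hS [x [y [z [Gx Gy Gz ng]]]]] minG] := hmin.
have leG : #|G| <= 128 by rewrite -card_ext (minG _ _ _ _ ext_setup_nontrivial).
have [Z2 ->] := small_setup hS Gx Gy Gz ng leG; split=> //.
have /cards1P[u def_u] : #|Z :\ 1| == 1%N.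
  by have := cardsD1 1 Z; rewrite Z2 group1 add1n => -[<-].
exists u; split; rewrite -def_u.
  apply/setP=> t; rewrite !inE andbC; case Zt: (t \in Z); rewrite ?andbF // !andbT.
  rewrite -order_eq1; have := order_dvdG Zt; rewrite Z2.
  move=> /(dvdn_leq (isT : 0 < 2)).
  by have := order_gt0 t; case: #[t] => [|[|[|]]].
have fZ a b c : a \in G -> b \in G -> c \in G -> setup_f delta a b c \in Z.
  by move=> Ga Gb Gc; rewrite (delta_rep_Z hS) ?groupR.
apply/eqP; rewrite eqEsubset; apply/andP; split.
  apply/setSD/subsetP=> _ /imsetP[[[a b] c] /= /setXP[/setXP[/= Ga Gb] Gc] ->].
  exact: fZ.
(* It suffices to find one nontrivial value of [f], since [u] is the only
   nontrivial element of [Z]. *)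
have hit a b c : a \in G -> b \in G -> c \in G -> setup_f delta a b c != 1 ->
    Z :\ 1 \subset Im3 G (setup_f delta) :\ 1.
  move=> Ga Gb Gc nf; have: setup_f delta a b c \in Z :\ 1 by rewrite !inE nf fZ.
  rewrite def_u inE sub1set => /eqP <-; rewrite !inE nf /=.
  by apply/imsetP; exists (a, b, c); rewrite // !inE Ga Gb.
have [f1|] := eqVneq (setup_f delta x y z) 1; last exact: hit.
have [f2|] := eqVneq (setup_f delta y z x) 1; last exact: hit.
have [f3|] := eqVneq (setup_f delta z x y) 1; last exact: hit.
by rewrite /setup_g f1 f2 f3 !mulg1 eqxx in ng.
Qed.
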